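(* Let $a,b\in\mathbb{C}_p$ with $|a-b|_p=R>0$ and $\mathcal{A}=\mathcal{A}(a,b)$. Suppose $x_{0} \in\mathbb{C}_p$, $x_0\notin \mathcal{A}$ and $|x_{0} - a|_{p} \leq R$. Then: (1) If $|x_{0} - a|_{p} < R$, then for every interlocked family $\Phi$ of path sequences, $$\int_{\mathcal{A},\Phi}\frac{1}{x - x_{0}}\,dx = 1;$$ (2) If $|x_{0} - a|_{p} = R$ (and $x_{0} \notin \mathcal{A}$), there is a $\lambda_{0}\in\mathbb{Z}^+$ such that for every $\alpha \in \mathbb{Z}_{\geq 0}$ $$\int_{\mathcal{A},\alpha + \lambda_{0}k}\frac{1}{x - x_{0}}\,dx \ = \ \frac{1}{1 - \omega\left(\frac{a - x_{0}}{a - b}\right)^{p^{\alpha}}}.$$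
   Context: $p$ is an odd prime; $\mathbb{C}_p$ is the completion of an algebraic closure of $\mathbb{Q}_p$, with $|p|_p=1/p$. Arc: for $a\ne b$ in $\mathbb{C}_p$ with $R=|a-b|_p$, the arc $\mathcal{A}(a,b)$ is the open disc $\{x : |x-b|_p<R\}$. Path sequence: a function $\varphi$ defined for all integers $k\ge k_0$ (some $k_0\in\mathbb{Z}^+$), with values in $\mathbb{Z}^+$ and strictly increasing. For $f:\mathcal{A}(a,b)\to\mathbb{C}_p$ put $A_{f,\varphi}(k)=p^{-\varphi(k)}\sum_{\zeta}(x-a)f(x)$, where $x=a+(b-a)\zeta$ and $\zeta$ runs through the $p^{\varphi(k)}$-th roots of unity. For a single path sequence $\varphi$, $\int_{\mathcal{A},\varphi}f(x)\,dx=\lim_{k\to\infty}A_{f,\varphi}(k)$ if the limit exists; $\int_{\mathcal{A},\alpha+\lambda_0k}$ means the integral with respect to the path sequence $\varphi(k)=\alpha+\lambda_0k$. A non-empty family $\Phi$ of path sequences is interlocked if for all $\varphi_1,\varphi_2\in\Phi$ there are $\varphi_3\in\Phi$ and $k_0$ such that $\varphi_3(k)$, $k\ge k_0$, is a subsequence of both $\varphi_1$ and $\varphi_2$. For interlocked $\Phi$, $\int_{\mathcal{A},\Phi}f(x)\,dx=L$ means: for every $\varepsilon>0$ there are $\varphi_\varepsilon\in\Phi$ and $K_\varepsilon$ with $|A_{f,\varphi_\varepsilon}(k)-L|_p<\varepsilon$ for all $k>K_\varepsilon$ (such $L$ is unique if it exists). $\omega$ is the Teichmüller character: for $|x|_p=1$,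 $\omega(x)$ is the unique root of unity of order prime to $p$ with $|x-\omega(x)|_p<1$; $\omega(x)=0$ if $|x|_p<1$. *)

(* Defs.v *)
From HB Require Import structures.
From mathcomp Require Import all_boot all_order all_algebra.
From mathcomp Require Import all_classical all_reals.
From mathcomp Require Import topology normedtype sequences.

Set Implicit Arguments.
Unset Strict Implicit.
Unset Printing Implicit Defensive.

Import Order.TTheory GRing.Theory Num.Theory.
Import numFieldNormedType.Exports.

Local Open Scope classical_set_scope.
Local Open Scope ring_scope.

Definition padic_abs (R : realType) (p : nat) (x : rat) : R :=
  if x == 0 then 0
  else p%:R ^ ((logn p `|denq x|)%:Z - (logn p `|numq x|)%:Z).

Record nonarch_absval (R : realType) (K : fieldType) (v : K -> R) : Prop := {
  absval_ge0 : forall x, 0 <= v x;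
  absval_eq0 : forall x, v x = 0 <-> x = 0;
  absvalM : forall x y, v (x * y) = v x * v y;
  absvalD : forall x y, v (x + y) <= Num.max (v x) (v y) }.

Definition absval_complete (R : realType) (K : fieldType) (v : K -> R) : Prop :=
  forall u : nat -> K,
    (forall e : R, 0 < e ->
       exists N : nat, forall m n, (N <= m)%N -> (N <= n)%N ->
         v (u m - u n) < e) ->
    exists l : K, v (u n - l) @[n --> \oo] --> (0 : R).

Record is_completion (R : realType) (K L : fieldType)
    (vK : K -> R) (vL : L -> R) (i : {rmorphism K -> L}) : Prop := {
  completion_absval : nonarch_absval vL;
  completion_isometry : forall x, vL (i x) = vK x;
  completion_dense : forall (y : L) (e : R), 0 < e -> exists x, vL (y - i x) < e;
  completion_complete : absval_complete vL }.

(* Q_p, its algebraic closure and C_p are determined only up to isometric      *)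
(* isomorphism, so C_p is presented by a tower Q -> Q_p -> Qpbar -> C_p        *)
(* satisfying the defining properties of its three steps. For p prime such a   *)
(* tower exists, and any two have isometrically isomorphic tops.               *)
Record padic_complex (R : realType) (p : nat) := PadicComplex {
  Qp : fieldType;
  Qp_abs : Qp -> R;
  rat_Qp : {rmorphism rat -> Qp};
  Qp_completion : is_completion (@padic_abs R p) Qp_abs rat_Qp;
  Qpbar : closedFieldType;
  Qpbar_abs : Qpbar -> R;
  Qp_Qpbar : {rmorphism Qp -> Qpbar};
  Qpbar_algebraic : forall x : Qpbar, algebraicOver Qp_Qpbar x;
  Qpbar_absval : nonarch_absval Qpbar_abs;
  Qpbar_absE : forall x, Qpbar_abs (Qp_Qpbar x) = Qp_abs x;
  Cp_field :> fieldType;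
  Cp_abs : Cp_field -> R;
  Qpbar_Cp : {rmorphism Qpbar -> Cp_field};
  Cp_completion : is_completion Qpbar_abs Cp_abs Qpbar_Cp }.

(* Only the values at k >= path_start are meaningful. *)
Record path_seq := PathSeq {
  path_start : nat;
  path_fun :> nat -> nat;
  path_start_gt0 : (0 < path_start)%N;
  path_fun_gt0 : forall k, (path_start <= k)%N -> (0 < path_fun k)%N;
  path_fun_incr : forall j k, (path_start <= j)%N -> (j < k)%N ->
    (path_fun j < path_fun k)%N }.

Program Definition affine_path (alpha lambda : nat) (lambda_gt0 : (0 < lambda)%N) :
    path_seq :=
  @PathSeq 1 (fun k => (alpha + lambda * k)%N) _ _ _.
Next Obligation. by []. Qed.
Next Obligation. by move=> a l l0 k k0; rewrite addn_gt0 muln_gt0 l0 k0 orbT. Qed.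
Next Obligation. by move=> a l l0 j k _ jk; rewrite ltn_add2l ltn_pmul2l. Qed.

Definition subsequence_from (k0 : nat) (psi phi : path_seq) : Prop :=
  exists s : nat -> nat,
    (forall k, (k0 <= k)%N -> (path_start phi <= s k)%N) /\
    (forall j k, (k0 <= j)%N -> (j < k)%N -> (s j < s k)%N) /\
    (forall k, (k0 <= k)%N -> psi k = phi (s k)).

Definition interlocked (Phi : set path_seq) : Prop :=
  Phi !=set0 /\
  forall phi1 phi2, Phi phi1 -> Phi phi2 ->
    exists phi3 (k0 : nat), Phi phi3 /\ (path_start phi3 <= k0)%N /\
      subsequence_from k0 phi3 phi1 /\ subsequence_from k0 phi3 phi2.

Section ArcIntegral.
Variables (R : realType) (p : nat) (Cp : padic_complex R p).
Implicit Types (a b x w L : Cp) (f : Cp -> Cp) (phi : path_seq).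

Definition padic_arc a b : set Cp := [set x | Cp_abs (x - b) < Cp_abs (a - b)].

(* f is total, but it is only evaluated on [padic_arc a b]: a p-power root of unity  *)
(* zeta satisfies |zeta - 1| < 1.                                              *)
Definition arc_sum a b f phi (k : nat) : Cp :=
  ((p ^ phi k)%N%:R)^-1 *
  \sum_(zeta \in [set z : Cp | (p ^ phi k)%N.-unity_root z])
    (let x := a + (b - a) * zeta in (x - a) * f x).

Definition has_path_integral a b phi f L : Prop :=
  Cp_abs (arc_sum a b f phi k - L) @[k --> \oo] --> (0 : R).

Definition has_family_integral a b (Phi : set path_seq) f L : Prop :=
  forall e : R, 0 < e ->
    exists phi (K : nat), Phi phi /\
      forall k, (path_start phi <= k)%N -> (K < k)%N ->
        Cp_abs (arc_sum a b f phi k - L) < e.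

Definition is_teichmuller x w : Prop :=
  (exists2 m : nat, coprime p m & m.-primitive_root w) /\ Cp_abs (x - w) < 1.

(* For |x| > 1, where omega is not defined, the value is 0 by convention. *)
Definition teichmuller x : Cp :=
  if Cp_abs x == 1 then xget 0 [set w | is_teichmuller x w] else 0.

End ArcIntegral.

(* Main.v *)
(** With [c = (a - x0) / (a - b)], the logarithmic derivative of [X^N - 1] at [c]
    turns the arc sum for [N = p^phi(k)] into [1 / (1 - c^N)], and [x0] lying outside
    the arc means [|1 - c| = 1], hence [|1 - c^N| = 1].  If [|c| < 1] then [c^N] tends
    to 0.  If [|c| = 1] then [c^(p^n) - w^(p^n)] tends to 0 for [w] the Teichmueller
    representative of [c], because [x |-> x^p] contracts residue discs, and
    [w^(p^n)] is periodic in [n] since [p] is prime to the order of [w].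
    The representative exists since [c] is near an element algebraic over [Q_p]:
    its powers fall into finitely many residue classes, so [|c^m - 1| < 1] for some
    [m] prime to [p], and one of the factors [c - w] of [c^m - 1] is small. *)
Require Import Defs.
From HB Require Import structures.
From mathcomp Require Import all_boot all_order all_algebra.
From mathcomp Require Import all_classical all_reals.
From mathcomp Require Import topology normedtype sequences.
From mathcomp Require Import cyclic separable cyclotomic ring.

Set Implicit Arguments.
Unset Strict Implicit.
Unset Printing Implicit Defensive.

Import Order.TTheory GRing.Theory Num.Theory.
Import numFieldNormedType.Exports.

Local Open Scope classical_set_scope.
Local Open Scope ring_scope.

(** * Non-archimedean absolute values *)

Section NonarchimedeanAbsval.
Variables (R : realType) (K : fieldType) (v : K -> R) (hv : nonarch_absval v).
Implicit Types x y z : K.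

Lemma absval0 : v 0 = 0. Proof. by apply/(absval_eq0 hv). Qed.

Lemma absval_neq0 x : x != 0 -> v x != 0.
Proof. by apply: contra_neq => /(absval_eq0 hv). Qed.

Lemma absval1 : v 1 = 1.
Proof.
have v1 := absval_neq0 (oner_neq0 K).
by apply: (mulfI v1); rewrite -(absvalM hv) !mulr1.
Qed.

Lemma absvalX x n : v (x ^+ n) = v x ^+ n.
Proof. by elim: n => [|n IH]; rewrite ?absval1// !exprS (absvalM hv) IH. Qed.

Lemma absvalV x : v x^-1 = (v x)^-1.
Proof.
have [->|x0] := eqVneq x 0; first by rewrite invr0 absval0 invr0.
by apply: (mulfI (absval_neq0 x0)); rewrite -(absvalM hv) !divff ?absval1// absval_neq0.
Qed.

Lemma absvalN x : v (- x) = v x.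
Proof.
have : v (- 1) ^+ 2 = 1 by rewrite -absvalX sqrrN expr1n absval1.
move=> /eqP; rewrite sqrf_eq1 => /orP[] /eqP v1.
  by rewrite -mulN1r (absvalM hv) v1 mul1r.
by have := absval_ge0 hv (-1); rewrite v1 oppr_ge0 lt_geF.
Qed.

Lemma absval_subC x y : v (x - y) = v (y - x).
Proof. by rewrite -absvalN opprB. Qed.

Lemma absvalD_le x y e : v x <= e -> v y <= e -> v (x + y) <= e.
Proof. by move=> xe ye; rewrite (le_trans (absvalD hv _ _))// ge_max xe. Qed.

Lemma absvalD_lt x y e : v x < e -> v y < e -> v (x + y) < e.
Proof. by move=> xe ye; rewrite (le_lt_trans (absvalD hv _ _))// gt_max xe. Qed.

Lemma absval_sum_le I (s : seq I) (P : pred I) (F : I -> K) e : 0 <= e ->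
  (forall i, P i -> v (F i) <= e) -> v (\sum_(i <- s | P i) F i) <= e.
Proof.
move=> e0 Fe; apply: (big_ind (fun x => v x <= e)) => //; first by rewrite absval0.
by move=> x y; exact: absvalD_le.
Qed.

Lemma absval_sum_lt I (s : seq I) (P : pred I) (F : I -> K) e : 0 < e ->
  (forall i, P i -> v (F i) < e) -> v (\sum_(i <- s | P i) F i) < e.
Proof.
move=> e0 Fe; apply: (big_ind (fun x => v x < e)) => //; first by rewrite absval0.
by move=> x y; exact: absvalD_lt.
Qed.

Lemma absval_nat_le1 n : v n%:R <= 1.
Proof. by elim: n => [|n IH]; rewrite ?absval0// -natr1 absvalD_le ?absval1. Qed.

(** Isosceles property: [y] is the sum of [- x] and [x + y], so these cannot both be smaller than
    [y]. *)
Lemma absvalD_eqr x y : v x < v y -> v (x + y) = v y.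
Proof.
move=> xy; apply/eqP; rewrite eq_le absvalD_le ?(ltW xy)//= leNgt.
apply/negP => xyy.
suff : v y < v y by rewrite ltxx.
by rewrite -{1}(addKr x y) absvalD_lt ?absvalN.
Qed.

Lemma absval_near_eq1 x y : v x = 1 -> v (x - y) < 1 -> v y = 1.
Proof.
by move=> x1 xy; rewrite -(subrK x y) absvalD_eqr x1// absval_subC.
Qed.

(* [v (x - y) < 1] says that [x] and [y] have the same residue class; the lemmas
   named [near_] compute in the residue field through this relation. *)
Lemma near_trans y x z : v (x - y) < 1 -> v (y - z) < 1 -> v (x - z) < 1.
Proof. by move=> xy yz; rewrite -[x](subrK y) -addrA absvalD_lt. Qed.

(** The cofactor of [x - y] in [x ^+ n - y ^+ n] is integral. *)
Lemma near_exp x y n : v x <= 1 -> v y <= 1 -> v (x - y) < 1 ->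
  v (x ^+ n - y ^+ n) < 1.
Proof.
move=> x1 y1 xy; rewrite subrXX (absvalM hv) (le_lt_trans _ xy)//.
rewrite ler_piMr ?(absval_ge0 hv)// absval_sum_le// => i _.
by rewrite (absvalM hv) !absvalX mulr_ile1 ?exprn_ge0 ?exprn_ile1 ?(absval_ge0 hv).
Qed.

Lemma absval_unity_root x n : (0 < n)%N -> x ^+ n = 1 -> v x = 1.
Proof.
move=> n_gt0 xn; apply/eqP; rewrite -(pexpr_eq1 n_gt0) ?(absval_ge0 hv)//.
by rewrite -absvalX xn absval1.
Qed.

(** * Frobenius and residue classes in residue characteristic [p] *)

Section ResidueCharacteristic.
Variables (p : nat) (p_prime : prime p) (vp_lt1 : v p%:R < 1).

Lemma absval_dvdn_lt1 n : (p %| n)%N -> v n%:R < 1.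
Proof.
move=> /dvdnP[k ->]; rewrite natrM (absvalM hv) (le_lt_trans _ vp_lt1)//.
by rewrite ler_piMl ?(absval_ge0 hv)// absval_nat_le1.
Qed.

(** With [t = x - y], each middle term of [(y + t) ^+ p] carries a factor [t] and a binomial
    coefficient divisible by [p]. *)
Lemma absval_frobenius_le x y : v x <= 1 -> v y <= 1 ->
  v (x ^+ p - y ^+ p - (x - y) ^+ p) <= v p%:R * v (x - y).
Proof.
move=> x1 y1; set t := x - y.
have t1 : v t <= 1 by rewrite absvalD_le ?absvalN.
have ex : x = y + t by rewrite addrC subrK.
rewrite ex; clearbody t; have p_gt0 := prime_gt0 p_prime.
rewrite exprDn; case: p p_gt0 p_prime => // q _ q_prime.
rewrite big_ord_recr big_ord_recl /= subnn subn0 bin0 binn !expr0 !mulr1n mulr1 mul1r.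
have cancel_ends (A S B : K) : A + S + B - A - B = S by ring.
rewrite cancel_ends.
apply: absval_sum_le => [|i _]; first by rewrite mulr_ge0 ?(absval_ge0 hv).
have /dvdnP[k ->] : (q.+1 %| 'C(q.+1, bump 0 i))%N.
  by apply: prime_dvd_bin; rewrite //= ltnS ltn_ord.
have v0 z : 0 <= v z := absval_ge0 hv z.
rewrite -mulr_natr natrM exprS.
have -> (A B k' P' : K) : A * (t * B) * (k' * P') = k' * A * B * (P' * t) by ring.
rewrite (absvalM hv) -[v q.+1%:R * _](absvalM hv) ler_piMl// !(absvalM hv) !absvalX.
by rewrite !mulr_ile1 ?mulr_ge0 ?exprn_ge0 ?exprn_ile1 ?absval_nat_le1.
Qed.

(** Frobenius is injective on the residue field, since [(x - y) ^+ p] is near [x ^+ p - y ^+ p]. *)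
Lemma absval_frobenius_lt1 x y : v x <= 1 -> v y <= 1 ->
  v (x ^+ p - y ^+ p) < 1 -> v (x - y) < 1.
Proof.
move=> x1 y1 xy; rewrite -(@ltr_pXn2r _ p) ?nnegrE ?prime_gt0 ?ler01 ?(absval_ge0 hv)//.
rewrite expr1n -absvalX -[_ ^+ p](subKr (x ^+ p - y ^+ p)) absvalD_lt// absvalN.
rewrite (le_lt_trans (absval_frobenius_le x1 y1))// (le_lt_trans _ vp_lt1)//.
by rewrite ler_piMr ?(absval_ge0 hv)// absvalD_le ?absvalN.
Qed.

Lemma absval_frobenius_iter_lt1 x y n : v x <= 1 -> v y <= 1 ->
  v (x ^+ (p ^ n) - y ^+ (p ^ n)) < 1 -> v (x - y) < 1.
Proof.
move=> x1 y1; elim: n => [|n IH]; first by rewrite !expr1.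
rewrite expnSr !exprM => /absval_frobenius_lt1 h; apply/IH/h.
  by rewrite absvalX exprn_ile1 ?(absval_ge0 hv).
by rewrite absvalX exprn_ile1 ?(absval_ge0 hv).
Qed.

Lemma absval_frobenius_contract x y : v x <= 1 -> v y <= 1 ->
  v (x ^+ p - y ^+ p) <= Num.max (v p%:R) (v (x - y)) * v (x - y).
Proof.
move=> x1 y1; have v0 z : 0 <= v z := absval_ge0 hv z.
rewrite -[_ - _](subrK ((x - y) ^+ p)) absvalD_le//.
  by rewrite (le_trans (absval_frobenius_le x1 y1))// ler_wpM2r// le_max lexx.
have xy1 : v (x - y) <= 1 by rewrite absvalD_le ?absvalN.
rewrite absvalX -(prednK (prime_gt0 p_prime)) exprSr ler_wpM2r// le_max; apply/orP; right.
by rewrite ler_iXnr// -subn1 subn_gt0 prime_gt1.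
Qed.

(** The distance never grows under [p]-th powers, so the initial ratio bounds every later
    contraction. *)
Lemma absval_frobenius_iter_le x y n : v x <= 1 -> v y <= 1 -> v (x - y) < 1 ->
  v (x ^+ (p ^ n) - y ^+ (p ^ n)) <= Num.max (v p%:R) (v (x - y)) ^+ n.
Proof.
move=> x1 y1 xy; set rho := Num.max _ _.
have rho0 : 0 <= rho by rewrite le_max (absval_ge0 hv).
have rho1 : rho <= 1 by rewrite ge_max !ltW.
suff : v (x ^+ (p ^ n) - y ^+ (p ^ n)) <= rho ^+ n * v (x - y).
  by move=> /le_trans -> //; rewrite ler_piMr ?exprn_ge0// ltW.
elim: n => [|n IH]; first by rewrite !expr1 expr0 mul1r.
have X1 z : v z <= 1 -> v (z ^+ (p ^ n)) <= 1.
  by move=> z1; rewrite absvalX exprn_ile1 ?(absval_ge0 hv).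
rewrite expnSr !exprM (le_trans (absval_frobenius_contract (X1 _ x1) (X1 _ y1)))//.
rewrite exprS -mulrA ler_pM ?(absval_ge0 hv)//; first by rewrite le_max (absval_ge0 hv).
rewrite ge_max le_max lexx /= (le_trans IH)// le_max; apply/orP; right.
by rewrite ler_piMl ?(absval_ge0 hv)// exprn_ile1.
Qed.

Lemma near_modn k x : v x <= 1 -> v (k%:R * x - (k %% p)%:R * x) < 1.
Proof.
move=> x1; rewrite -mulrBl (absvalM hv) {1}(divn_eq k p) natrD addrK.
by rewrite (le_lt_trans _ (absval_dvdn_lt1 (dvdn_mull (k %/ p) (dvdnn p))))// ler_piMr ?(absval_ge0 hv).
Qed.

(** Multiplying by [c] and replacing [c ^+ d] through the relation stays in the span of the lower
    powers. Natural coefficients can later be reduced mod [p]. *)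
Lemma near_pow_of_near_monic d (b : nat -> nat) c : v c = 1 ->
  v (c ^+ d - \sum_(i < d) (b i)%:R * c ^+ i) < 1 ->
  forall k, exists g : nat -> nat, v (c ^+ k - \sum_(i < d) (g i)%:R * c ^+ i) < 1.
Proof.
move=> c1; case: d => [|d] cb; first by move: cb; rewrite big_ord0 subr0 absval1 ltxx.
elim=> [|k [g cg]].
  exists (fun i => (i == 0)%N); rewrite big_ord_recl big1 ?addr0 => [|i _].
    by rewrite expr0 mulr1 subrr absval0.
  by rewrite mul0r.
(* Digits shift up by one; the overflowing top digit [g d] is spread along the relation. *)
exists (fun i => ((if i is j.+1 then g j else 0) + g d * b i)%N).
under eq_bigr => i _ do rewrite natrD natrM mulrDl -mulrA.
rewrite big_split -mulr_sumr /= big_ord_recl mul0r add0r.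
have -> : c ^+ k.+1 - (\sum_(i < d) (g i)%:R * c ^+ i.+1 +
    (g d)%:R * \sum_(i < d.+1) (b i)%:R * c ^+ i) =
    c * (c ^+ k - \sum_(i < d.+1) (g i)%:R * c ^+ i) +
    (g d)%:R * (c ^+ d.+1 - \sum_(i < d.+1) (b i)%:R * c ^+ i).
  have -> : \sum_(i < d) (g i)%:R * c ^+ i.+1 = c * \sum_(i < d) (g i)%:R * c ^+ i.
    by rewrite mulr_sumr; apply: eq_bigr => i _; rewrite exprS mulrCA.
  by rewrite [X in c * (_ - X)]big_ord_recr /= !exprS; ring.
rewrite absvalD_lt// (absvalM hv) ?c1 ?mul1r// (le_lt_trans _ cb)//.
by rewrite ler_piMl ?(absval_ge0 hv)// absval_nat_le1.
Qed.

(* Each power of [c] is near one of the [p ^ d] combinations with digits below [p]. *)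
Lemma near_unity_of_near_monic d (b : nat -> nat) c : v c = 1 ->
  v (c ^+ d - \sum_(i < d) (b i)%:R * c ^+ i) < 1 ->
  exists2 m, (0 < m)%N & v (c ^+ m - 1) < 1.
Proof.
move=> c1 cb; have p_gt0 := prime_gt0 p_prime.
have [g cg] := choice (near_pow_of_near_monic c1 cb).
pose F k := [ffun i : 'I_d => Ordinal (ltn_pmod (g k i) p_gt0)].
have Fnear i j : F i = F j -> v (c ^+ i - c ^+ j) < 1.
  move=> Fij; apply: near_trans (cg i) _; rewrite absval_subC.
  apply: near_trans (cg j) _; rewrite -sumrB absval_sum_lt// => l _.
  have vcl : v (c ^+ l) <= 1 by rewrite absvalX c1 expr1n.
  apply: near_trans (near_modn _ vcl) _.
  have /(congr1 val) := congr1 (fun f : {ffun 'I_d -> 'I_p} => f l) Fij.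
  by rewrite !ffunE /= => <-; rewrite absval_subC near_modn.
(* Pigeonhole: one more exponent than there are digit vectors. *)
have : ~~ injectiveb (fun i : 'I_(#|{ffun 'I_d -> 'I_p}|.+1) => F i).
  by apply/injectiveP => /leq_card; rewrite card_ord ltnn.
move=> /injectivePn[i [j ij Fij]].
wlog ltij : i j ij Fij / (i < j)%N.
  move=> H; have [|ji] := ltnP i j; first exact: H Fij.
  by apply: (H j i) => //; rewrite 1?eq_sym// ltn_neqAle ji andbT eq_sym.
exists (j - i)%N; first by rewrite subn_gt0.
have := Fnear _ _ Fij; rewrite absval_subC -{1}(subnK (ltnW ltij)) exprD.
by rewrite -{2}[c ^+ i]mul1r -mulrBl (absvalM hv) absvalX c1 expr1n mulr1.
Qed.

(** A Bezout relation, read modulo [p]. *)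
Lemma near_inv_of_coprime n : coprime p n -> exists k, v (k%:R * n%:R - 1) < 1.
Proof.
have [->|n_gt0] := posnP n.
  by rewrite /coprime gcdn0 => /eqP p1; have := prime_gt1 p_prime; rewrite p1.
rewrite coprime_sym => /eqP np.
have [k l kl _] := egcdnP p n_gt0; exists k.
by rewrite -natrM kl np natrD addrK absval_dvdn_lt1// dvdn_mull.
Qed.

Lemma absval_coprime n : coprime p n -> v n%:R = 1.
Proof.
move=> /near_inv_of_coprime[k kn]; have v0 z : 0 <= v z := absval_ge0 hv z.
have : v (k%:R * n%:R) = 1.
  by apply: (@absval_near_eq1 1); rewrite ?absval1// absval_subC.
rewrite (absvalM hv) => kn1; apply/eqP; rewrite eq_le absval_nat_le1 /=.
by rewrite -kn1 ler_piMl ?absval_nat_le1.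
Qed.

Lemma near_nat_int (z : int) : exists n : nat, v (z%:~R - n%:R) < 1.
Proof.
case: z => m; first by exists m; rewrite -pmulrn subrr absval0.
(* This natural number exceeds the negative integer by [p * m.+1]. *)
exists (p.-1 * m.+1)%N; rewrite NegzE mulrNz -opprD absvalN -pmulrn -natrD.
by rewrite -mulSn prednK ?prime_gt0// absval_dvdn_lt1// dvdn_mulr.
Qed.

(** Integrality keeps [p] out of the reduced denominator, which is then invertible modulo [p]; the
    witness is the numerator times that inverse. *)
Lemma near_nat_rat (i : {rmorphism rat -> K}) (q : rat) : v (i q) <= 1 ->
  exists n : nat, v (i q - n%:R) < 1.
Proof.
have v0 z : 0 <= v z := absval_ge0 hv z.
have absval_int (z : int) : v z%:~R = v `|z|%N%:R.
  by case: z => m //=; rewrite NegzE mulrNz absvalN -pmulrn.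
have den0 : (denq q)%:~R != 0 :> K.
  by rewrite -(rmorph_int i) fmorph_eq0 intr_eq0 denq_neq0.
have iq : i q * (denq q)%:~R = (numq q)%:~R.
  by rewrite -{1}(divq_num_den q) fmorph_div !rmorph_int divfK.
move=> iq1; have cop_den : coprime p `|denq q|.
  rewrite prime_coprime//; apply/negP => p_den.
  have : v (i q * (denq q)%:~R) < 1.
    rewrite (absvalM hv) absval_int (le_lt_trans _ (absval_dvdn_lt1 p_den))//.
    by rewrite ler_piMl.
  rewrite iq absval_int absval_coprime ?ltxx//.
  by rewrite coprime_sym (coprime_dvdr p_den)// coprime_num_den.
have [k kden] := near_inv_of_coprime cop_den.
have [n numn] := near_nat_int (numq q).
have den_nat : (denq q)%:~R = `|denq q|%N%:R :> K by rewrite -[in LHS]absz_denq -pmulrn.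
exists (n * k)%N; rewrite natrM.
have -> : i q - n%:R * k%:R = - i q * (k%:R * `|denq q|%N%:R - 1) +
    k%:R * (i q * `|denq q|%N%:R - n%:R) by ring.
rewrite absvalD_lt// (absvalM hv).
  by rewrite (le_lt_trans _ kden)// ler_piMl ?absvalN.
by rewrite -den_nat iq (le_lt_trans _ numn)// ler_piMl ?absval_nat_le1.
Qed.

End ResidueCharacteristic.
(* A root of [P] divided by its last coefficient of maximal absolute value is near a
   monic relation with integral coefficients. *)
Lemma near_monic_of_root (P : {poly K}) c : v c = 1 -> P != 0 -> root P c ->
  exists d,
    (forall i : 'I_d, v (P`_i / P`_d) <= 1) /\
    v (c ^+ d + \sum_(i < d) P`_i / P`_d * c ^+ i) < 1.
Proof.
move=> c1 P0 /eqP; rewrite horner_coef; set n := size P => Pc.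
have n_gt0 : (0 < n)%N by rewrite lt0n size_poly_eq0.
have [j _ jmax] := @arg_maxP _ _ _ (Ordinal n_gt0) xpredT (fun i : 'I_n => v P`_i) isT.
have [d /eqP dj dmax] := @arg_maxnP _ j (fun i : 'I_n => v P`_i == v P`_j) val (eqxx _).
have v0 z : 0 <= v z := absval_ge0 hv z.
have vd_gt0 : 0 < v P`_d.
  have lead_ltn : (n.-1 < n)%N by rewrite prednK.
  rewrite dj (lt_le_trans _ (jmax (Ordinal lead_ltn) isT))//= lt0r v0 andbT.
  by rewrite absval_neq0// -/(lead_coef P) lead_coef_eq0.
have Pd0 : P`_d != 0 by apply: contraTneq vd_gt0 => ->; rewrite absval0 ltxx.
have le1 (i : 'I_n) : v (P`_i / P`_d) <= 1.
  by rewrite (absvalM hv) absvalV ler_pdivrMr// mul1r dj; exact: jmax.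
exists d.
split=> [i|]; first exact: (le1 (widen_ord (ltnW (ltn_ord d)) i)).
have : \sum_(i < n) P`_i / P`_d * c ^+ i = 0.
  have := congr1 (fun x => x / P`_d) Pc; rewrite mul0r mulr_suml; apply: etrans.
  by apply: eq_bigr => i _; rewrite mulrAC.
rewrite -(big_mkord xpredT (fun i => P`_i / P`_d * c ^+ i)).
(* The terms beyond [d] have strictly smaller coefficients, [d] being the last maximal index; they
   form the error. *)
rewrite (big_cat_nat (n := d))//= ?(ltnW (ltn_ord d))// [in X in _ + X]big_ltn ?ltn_ord//.
rewrite divff// mul1r big_mkord addrA => /eqP; rewrite addr_eq0 => /eqP.
rewrite addrC => ->; rewrite absvalN big_nat absval_sum_lt// => i /andP[di ltin].
rewrite (absvalM hv) absvalX c1 expr1n mulr1 (absvalM hv) absvalV ltr_pdivrMr// mul1r dj.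
rewrite lt_neqAle; apply/andP; split; last exact: (jmax (Ordinal ltin)).
by apply: contraTN di => vi; rewrite -leqNgt; exact: (dmax (Ordinal ltin)).
Qed.

End NonarchimedeanAbsval.

(** The logarithmic derivative of a split polynomial. *)
Lemma sum_inv_subr (F : fieldType) (s : seq F) (c : F) : c \notin s ->
  \sum_(z <- s) (c - z)^-1 =
  (\prod_(z <- s) ('X - z%:P))^`().[c] / (\prod_(z <- s) ('X - z%:P)).[c].
Proof.
elim: s => [|z s IH]; first by rewrite !big_nil derivC hornerC mul0r.
rewrite inE negb_or => /andP[cz cs]; rewrite !big_cons IH//.
rewrite derivM !hornerE derivXsubC hornerC mul1r.
set P := \prod_(_ <- _) _.
have P0 : P.[c] != 0 by rewrite -[_ == 0]/(root P c) root_prod_XsubC.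
by field; rewrite P0 subr_eq0 cz.
Qed.

(** * Sums over roots of unity in [Cp] *)

Section PadicComplex.
Variables (R : realType) (p : nat) (Cp : padic_complex R p).
Hypothesis p_prime : prime p.

Let hv : nonarch_absval (@Cp_abs R p Cp) := completion_absval (Cp_completion Cp).

Lemma Qp_abs_nat n : Qp_abs (n%:R : Qp Cp) = padic_abs R p n%:R.
Proof. by rewrite -(completion_isometry (Qp_completion Cp)) rmorph_nat. Qed.

Lemma Qpbar_abs_nat n : Qpbar_abs (n%:R : Qpbar Cp) = padic_abs R p n%:R.
Proof. by rewrite -Qp_abs_nat -Qpbar_absE rmorph_nat. Qed.

Lemma Cp_abs_nat n : Cp_abs (n%:R : Cp) = padic_abs R p n%:R.
Proof.
by rewrite -Qpbar_abs_nat -(completion_isometry (Cp_completion Cp)) rmorph_nat.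
Qed.

Lemma padic_abs_p_lt1 : padic_abs R p p%:R < 1.
Proof.
have p0 : (0 < p)%N := prime_gt0 p_prime.
rewrite /padic_abs pnatr_eq0 eqn0Ngt p0 /= -[p%:R : rat]/(p%:Q) denq_int numq_int /= logn1 logn_prime// eqxx.
by rewrite sub0r exprN1 invf_lt1 ?ltr1n ?prime_gt1// ltr0n.
Qed.

Lemma natr_Qpbar_neq0 n : (0 < n)%N -> (n%:R : Qpbar Cp) != 0.
Proof.
move=> n0; rewrite -(rmorph_nat (Qp_Qpbar Cp)) fmorph_eq0.
by rewrite -(rmorph_nat (rat_Qp Cp)) fmorph_eq0 pnatr_eq0 -lt0n.
Qed.

Lemma natr_Cp_neq0 n : (0 < n)%N -> (n%:R : Cp) != 0.
Proof.
by move=> n0; rewrite -(rmorph_nat (Qpbar_Cp Cp)) fmorph_eq0 natr_Qpbar_neq0.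
Qed.

(** The roots are taken in the algebraically closed [Qpbar] and mapped to [Cp]. Characteristic 0
    gives separability, hence distinct roots. *)
Lemma Xn_sub_1_split n : (0 < n)%N ->
  exists2 s : seq Cp, uniq s & 'X^n - 1 = \prod_(z <- s) ('X - z%:P).
Proof.
move=> n0; have [s Xs] := closed_field_poly_normal ('X^n - 1 : {poly Qpbar Cp}).
have mon : ('X^n - 1 : {poly Qpbar Cp}) \is monic by rewrite monicXnsubC.
rewrite (monicP mon) scale1r in Xs.
exists (map (Qpbar_Cp Cp) s).
  rewrite map_inj_uniq; last exact: fmorph_inj.
  by rewrite -separable_prod_XsubC -Xs separable_Xn_sub_1// natr_Qpbar_neq0.
have := congr1 (map_poly (Qpbar_Cp Cp)) Xs.
rewrite rmorphB rmorph1 /= map_polyXn => ->.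
rewrite rmorph_prod big_map; apply: eq_bigr => z _.
by rewrite rmorphB /= map_polyX map_polyC.
Qed.

(** Writing [z / (z - c)] as [1 - c / (c - z)] leaves [n] minus [c] times the logarithmic derivative
    of ['X^n - 1] at [c]. *)
Lemma sum_unity_roots n c : (0 < n)%N -> c ^+ n != 1 ->
  n%:R^-1 * \sum_(z \in [set z : Cp | n.-unity_root z]) z / (z - c) = 1 / (1 - c ^+ n).
Proof.
move=> n0 cn; have [s us Xs] := Xn_sub_1_split n0.
have mem_s z : (z \in s) = (n.-unity_root z) by rewrite -root_prod_XsubC -Xs.
have -> : [set z : Cp | n.-unity_root z] = [set` s].
  by apply/seteqP; split=> z /=; rewrite mem_s.
rewrite -fsbig_seq//.
have cs : c \notin s by rewrite mem_s unity_rootE.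
have cn0 : 1 - c ^+ n != 0 by rewrite subr_eq0 eq_sym.
have sizes : (size s).+1 = n.+1 by rewrite -(size_prod_XsubC s id) -Xs -polyC1 size_XnsubC.
have -> : \sum_(z <- s) z / (z - c) = \sum_(z <- s) (1 - c * (c - z)^-1).
  rewrite !big_seq; apply: eq_bigr => z zs.
  have zc : z - c != 0 by rewrite subr_eq0; apply: contraNneq cs => <-.
  by field; rewrite zc -opprB oppr_eq0 zc.
rewrite sumrB big_const_seq count_predT iter_addr_0 -mulr_sumr sum_inv_subr// -Xs.
rewrite derivB derivXn -polyC1 derivC subr0 !hornerE hornerMn hornerXn /=.
case: sizes => ->; have nn0 := natr_Cp_neq0 n0; rewrite -mulr_natr.
have cnE : c ^+ n = c * c ^+ n.-1 by rewrite -exprS prednK.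
rewrite cnE in cn0 *.
by field; rewrite nn0 cn0 -opprB oppr_eq0 cn0.
Qed.

(** * Residue classes and Teichmueller representatives in [Cp] *)

Lemma Cp_abs_p_lt1 : Cp_abs (p%:R : Cp) < 1.
Proof. by rewrite Cp_abs_nat padic_abs_p_lt1. Qed.

(** By density [x] shares its residue class with an integral rational. *)
Lemma Qp_near_nat (x : Qp Cp) : Qp_abs x <= 1 ->
  exists n : nat, Qp_abs (x - n%:R) < 1.
Proof.
have hQp := completion_absval (Qp_completion Cp).
have vp : Qp_abs (p%:R : Qp Cp) < 1 by rewrite Qp_abs_nat padic_abs_p_lt1.
move=> x1; have [q xq] := completion_dense (Qp_completion Cp) x (@ltr01 R).
have q1 : Qp_abs (rat_Qp Cp q) <= 1.
  by rewrite -[rat_Qp _ _](subKr x) (absvalD_le hQp)// (absvalN hQp) ltW.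
have [n qn] := near_nat_rat hQp p_prime vp q1.
by exists n; exact: near_trans xq qn.
Qed.

(** A polynomial over [Qp] killing [c] gives a near-monic relation whose integral coefficients may
    be replaced by natural numbers. *)
Lemma Qpbar_near_unity (c : Qpbar Cp) : Qpbar_abs c = 1 ->
  exists2 m, (0 < m)%N & Qpbar_abs (c ^+ m - 1) < 1.
Proof.
move=> c1; have h := Qpbar_absval Cp.
have vp : Qpbar_abs (p%:R : Qpbar Cp) < 1 by rewrite Qpbar_abs_nat padic_abs_p_lt1.
have [P P0 Pc] := Qpbar_algebraic c.
have [|d [Pd cd]] := near_monic_of_root h c1 _ Pc; first by rewrite map_poly_eq0.
have /choice[b Pb] (i : 'I_d) : exists n : nat, Qp_abs (- (P`_i / P`_d) - n%:R) < 1.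
  apply: Qp_near_nat; rewrite (absvalN (completion_absval (Qp_completion Cp))).
  by have := Pd i; rewrite !coef_map -fmorph_div Qpbar_absE.
(* Extends [b] from ['I_d] to all naturals; the default 0 is never reached in the sum. *)
pose b' k := if insub k is Some i then b i else 0%N.
apply: (near_unity_of_near_monic h p_prime vp (b := b') c1 (d := d)).
rewrite -[X in c ^+ d + X]opprK in cd. apply: (near_trans h cd _).
rewrite -sumrN -sumrB (absval_sum_lt h)// => i _.
rewrite /b' valK !coef_map -fmorph_div -mulNr -mulrBl (absvalM h) (absvalX h) c1.
by rewrite expr1n mulr1 -rmorphN -(rmorph_nat (Qp_Qpbar Cp)) -rmorphB Qpbar_absE.
Qed.

Lemma Cp_near_unity (c : Cp) : Cp_abs c = 1 ->
  exists m, [/\ (0 < m)%N, coprime p m & Cp_abs (c ^+ m - 1) < 1].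
Proof.
move=> c1; have [c0 cc0] := completion_dense (Cp_completion Cp) c (@ltr01 R).
have ic01 := absval_near_eq1 hv c1 cc0.
have [|m m_gt0 cm] := @Qpbar_near_unity c0.
  by rewrite -(completion_isometry (Cp_completion Cp)).
have cm1 : Cp_abs (c ^+ m - 1) < 1.
  apply: (near_trans hv (y := Qpbar_Cp Cp c0 ^+ m)).
    by rewrite (near_exp hv) ?c1 ?ic01.
  by rewrite -rmorphXn -(rmorph1 (Qpbar_Cp Cp)) -rmorphB (completion_isometry (Cp_completion Cp)).
(* Injectivity of Frobenius strips the [p]-part from the exponent [m]. *)
have [q pq mq] := pfactor_coprime p_prime m_gt0.
have q_gt0 : (0 < q)%N by move: m_gt0; rewrite mq muln_gt0 => /andP[].
exists q; split=> //; apply: (absval_frobenius_iter_lt1 hv p_prime Cp_abs_p_lt1 (n := logn p m)).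
- by rewrite (absvalX hv) c1 expr1n.
- by rewrite (absval1 hv).
- by rewrite expr1n -exprM -mq.
Qed.

Lemma teichmuller_exists (c : Cp) : Cp_abs c = 1 -> exists w, is_teichmuller c w.
Proof.
move=> c1; have [m [m_gt0 pm cm]] := Cp_near_unity c1.
have [s _ Xs] := Xn_sub_1_split m_gt0.
have s_unity w : w \in s -> w ^+ m = 1.
  by rewrite -root_prod_XsubC -Xs => /unity_rootP.
have : exists2 w, w \in s & Cp_abs (c - w) < 1.
  (* If [c] were far from every [m]-th root of unity, all factors of [c ^+ m - 1] would have
     absolute value 1. *)
  apply: contrapT => far.
  suff : Cp_abs (c ^+ m - 1) = 1 by move=> e; move: cm; rewrite e ltxx.
  have -> : c ^+ m - 1 = ('X^m - 1).[c] by rewrite !hornerE.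
  rewrite Xs horner_prod big_seq; apply: (big_ind (fun x => Cp_abs x = 1)).
  - exact: (absval1 hv).
  - by move=> x y x1 y1; rewrite (absvalM hv) x1 y1 mulr1.
  - move=> w ws; rewrite !hornerE; apply/eqP; rewrite eq_le leNgt; apply/andP; split.
      have w1 : Cp_abs w <= 1.
        by rewrite (absval_unity_root hv m_gt0 (s_unity _ ws)).
      by rewrite -leNgt (absvalD_le hv) ?(absvalN hv) ?c1.
    by rewrite leNgt; apply/negP => cw; apply: far; exists w.
move=> [w ws cw]; exists w; split=> //.
have [l wl lm] := prim_order_exists m_gt0 (s_unity _ ws).
by exists l => //; exact: coprime_dvdr lm pm.
Qed.

(** Existence ensures that [xget] returns a genuine representative, not its default. *)
Lemma teichmullerP (c : Cp) : Cp_abs c = 1 -> is_teichmuller c (teichmuller c).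
Proof.
move=> c1; rewrite /teichmuller c1 eqxx.
by have [w] := teichmuller_exists c1; exact: xgetI.
Qed.

(** * Closed form of the arc sums *)

Section Arc.
Variables (a b x0 : Cp).
Hypotheses (ab : a - b != 0) (x0_notin : ~ padic_arc a b x0)
  (x0_le : Cp_abs (x0 - a) <= Cp_abs (a - b)).
Let c := (a - x0) / (a - b).

Lemma ratio_le1 : Cp_abs c <= 1.
Proof.
have ab_gt0 : 0 < Cp_abs (a - b) by rewrite lt0r (absval_neq0 hv)// (absval_ge0 hv).
by rewrite (absvalM hv) (absvalV hv) ler_pdivrMr// mul1r (absval_subC hv).
Qed.

(** [1 - c] equals [(x0 - b) / (a - b)], and [x0] lies outside the arc. *)
Lemma absval_1_sub_ratio : Cp_abs (1 - c) = 1.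
Proof.
have ab_gt0 : 0 < Cp_abs (a - b) by rewrite lt0r (absval_neq0 hv)// (absval_ge0 hv).
apply/eqP; rewrite eq_le (absvalD_le hv) ?(absval1 hv) ?(absvalN hv) ?ratio_le1//=.
rewrite leNgt; apply/negP => c1; apply: x0_notin; rewrite /padic_arc /=.
have -> : x0 - b = (1 - c) * (a - b) by rewrite /c; field.
by rewrite (absvalM hv) -[ltRHS]mul1r ltr_pM2r.
Qed.

(** Otherwise injectivity of Frobenius, applied to 1 and [c], would make [1 - c] small. *)
Lemma absval_1_sub_ratio_exp n : Cp_abs (1 - c ^+ (p ^ n)) = 1.
Proof.
have c1 := ratio_le1; have X1 : Cp_abs (c ^+ (p ^ n)) <= 1.
  by rewrite (absvalX hv) exprn_ile1 ?(absval_ge0 hv).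
apply/eqP; rewrite eq_le (absvalD_le hv) ?(absval1 hv) ?(absvalN hv)//= leNgt.
apply/negP; rewrite -{1}[1](expr1n _ (p ^ n)) => cn.
have := absval_frobenius_iter_lt1 hv p_prime Cp_abs_p_lt1 _ c1 cn.
by rewrite (absval1 hv) absval_1_sub_ratio ltxx => /(_ (lexx _)).
Qed.

Lemma arc_sum_inv_subr (phi : path_seq) k :
  arc_sum a b (fun x => 1 / (x - x0)) phi k = 1 / (1 - c ^+ (p ^ phi k)).
Proof.
have := absval_1_sub_ratio_exp (phi k).
rewrite /arc_sum; set N := (p ^ phi k)%N => cN.
have N_gt0 : (0 < N)%N by rewrite expn_gt0 prime_gt0.
have cN1 : c ^+ N != 1.
  apply/eqP => e; move: cN; rewrite e subrr (absval0 hv) => /eqP.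
  by rewrite eq_sym oner_eq0.
rewrite -(sum_unity_roots N_gt0 cN1); congr (_ * _); apply: eq_fsbigr => z _ /=.
have ba : b - a != 0 by rewrite -opprB oppr_eq0.
(* The factor [b - a] cancels against the one in [x - a], leaving [z / (z - c)]. *)
have -> : a + (b - a) * z - x0 = (b - a) * (z - c) by rewrite /c; field.
by rewrite addrAC subrr add0r div1r invfM mulrACA divff// mul1r.
Qed.

End Arc.


(** * Convergence of the arc sums *)

Lemma path_fun_ge (phi : path_seq) k : (path_start phi <= k)%N ->
  (k - path_start phi <= phi k)%N.
Proof.
elim: k => [|k IH]; first by rewrite sub0n.
rewrite leq_eqVlt ltnS => /orP[/eqP <-|sk]; first by rewrite subnn.
by rewrite subSn// (leq_ltn_trans (IH sk))// path_fun_incr.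
Qed.

(** Reduces convergence of the arc sums to convergence of powers of [c]. *)
Lemma absval_inv_subr_dist (x y : Cp) : Cp_abs (1 - x) = 1 -> Cp_abs (1 - y) = 1 ->
  Cp_abs (1 / (1 - x) - 1 / (1 - y)) = Cp_abs (x - y).
Proof.
have ne0 (z : Cp) : Cp_abs (1 - z) = 1 -> 1 - z != 0.
  by apply: contra_eq_neq => ->; rewrite (absval0 hv) eq_sym oner_neq0.
move=> x1 y1; have -> : 1 / (1 - x) - 1 / (1 - y) = (x - y) / ((1 - x) * (1 - y)).
  by field; rewrite !ne0.
by rewrite (absvalM hv) (absvalV hv) (absvalM hv) x1 y1 mulr1 invr1 mulr1.
Qed.

End PadicComplex.

Theorem theorem4p5 (R : realType) (p : nat) (p_prime : prime p) (p_odd : odd p)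
    (Cp : padic_complex R p) (a b x0 : Cp) (r : R)
    (r_gt0 : 0 < r) (abr : Cp_abs (a - b) = r)
    (x0_notin : ~ padic_arc a b x0) (x0_le : Cp_abs (x0 - a) <= r) :
  (Cp_abs (x0 - a) < r ->
    forall Phi : set path_seq, interlocked Phi ->
      has_family_integral a b Phi (fun x => 1 / (x - x0)) 1) /\
  (Cp_abs (x0 - a) = r ->
    exists (lambda0 : nat) (lambda0_gt0 : (0 < lambda0)%N),
      forall alpha : nat,
        has_path_integral a b (affine_path alpha lambda0_gt0)
          (fun x => 1 / (x - x0))
          (1 / (1 - teichmuller ((a - x0) / (a - b)) ^+ (p ^ alpha)))).
Proof.
have hv := completion_absval (Cp_completion Cp).
have vp := Cp_abs_p_lt1 Cp p_prime.
have ab : a - b != 0.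
  by apply/eqP => e; move: r_gt0; rewrite -abr e (absval0 hv) ltxx.
rewrite -abr in x0_le *; set c := (a - x0) / (a - b).
have sumE := arc_sum_inv_subr p_prime ab x0_notin x0_le.
have cN1 := absval_1_sub_ratio_exp p_prime ab x0_notin x0_le.
have cE : Cp_abs c = Cp_abs (x0 - a) / r.
  by rewrite (absvalM hv) (absvalV hv) abr (absval_subC hv).
split.
- move=> x0_lt Phi [[phi Phi_phi] _] e e_gt0.
  have c_lt1 : Cp_abs c < 1 by rewrite cE -abr ltr_pdivrMr ?abr// mul1r -abr.
  have vc0 : 0 <= Cp_abs c := absval_ge0 hv c.
  have /cvgrPdist_lt/(_ e e_gt0)[K _ Ke] := @cvg_expr R (Cp_abs c) ltac:(by rewrite ger0_norm).
  (* The offset gives [K < k - path_start phi <= phi k < p ^ phi k]. *)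
  exists phi, (K + path_start phi)%N; split=> // k sk Kk.
  (* The limit 1 is the value at the limit 0 of the powers of [c]. *)
  have one_frac : 1 = 1 / (1 - 0) :> Cp by rewrite subr0 divr1.
  rewrite sumE [X in _ - X]one_frac absval_inv_subr_dist ?cN1 ?subr0 ?(absval1 hv)// (absvalX hv).
  have := Ke (p ^ phi k)%N; rewrite /= sub0r normrN ger0_norm ?exprn_ge0//; apply.
  rewrite ltnW// (leq_ltn_trans _ (ltn_expl _ (prime_gt1 p_prime)))//.
  by rewrite (leq_trans _ (path_fun_ge sk))// -(leq_add2r (path_start phi)) subnK// ltnW.
- move=> x0_eq.
  have c1 : Cp_abs c = 1 by rewrite cE x0_eq abr divff ?gt_eqF.
  have [[m pm w_prim] cw] := teichmullerP p_prime c1; set w := teichmuller c in w_prim cw *.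
  have m_gt0 := prim_order_gt0 w_prim.
  have w1 : Cp_abs w = 1 := absval_unity_root hv m_gt0 (prim_expr_order w_prim).
  have l_gt0 : (0 < totient m)%N by rewrite totient_gt0.
  (* By Euler, [p ^ totient m] is 1 modulo the order [m] of [w], so [w ^+ (p ^ n)] is constant along
     the path. *)
  exists (totient m), l_gt0 => alpha.
  have w_period k : w ^+ (p ^ (alpha + totient m * k)) = w ^+ (p ^ alpha).
    apply/eqP; rewrite (eq_prim_root_expr w_prim) expnD expnM.
    by rewrite -modnMmr -modnXm Euler_exp_totient// modnXm exp1n modnMmr muln1.
  have wN1 k : Cp_abs (1 - w ^+ (p ^ k)) = 1.
    apply: (absval_near_eq1 hv (cN1 k)); rewrite opprB addrC addrA subrK (absval_subC hv).
    by rewrite (near_exp hv) ?c1 ?w1.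
  (* The contraction ratio for the residue class shared by [c] and [w]. *)
  set rho := Num.max (Cp_abs (p%:R : Cp)) (Cp_abs (c - w)).
  have rho0 : 0 <= rho by rewrite le_max (absval_ge0 hv).
  have rho1 : rho < 1 by rewrite gt_max vp.
  apply: (@squeeze_cvgr _ _ _ _ (cst 0) (fun k => rho ^+ k)).
  + near=> k; rewrite (absval_ge0 hv) sumE absval_inv_subr_dist ?cN1 ?wN1//=.
    (* Periodicity gives both powers the same exponent; it is at least [k], so [rho ^+ k] is a
       bound. *)
    rewrite -(w_period k) (le_trans (absval_frobenius_iter_le hv p_prime vp _ _ _ cw)) ?c1 ?w1//.
    rewrite ler_wiXn2l ?(ltW rho1)//.
    by rewrite (leq_trans _ (leq_addl _ _))// leq_pmull.
  + exact: cvg_cst.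
  + by apply: cvg_expr; rewrite ger0_norm.
Unshelve. all: by end_near. Qed.
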